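(* Let $d\geq 1$ be an integer and let $\mathcal{R}$ be the collection of all $d$-regular graphs. For every graph $H$ there exists a non-negative integer $n'$ such that $\chi_{\mathcal{R}}(H\oplus K_n)=\chi^L_{\mathcal{R}}(H\oplus K_n)$ for every integer $n\geq n'$.
   Context: All graphs are finite, simple and undirected. For a collection $\mathcal{G}$ of graphs, a graph $H$ is $\mathcal{G}$-free if $H$ contains no subgraph isomorphic to any member of $\mathcal{G}$. A $k$-$\mathcal{G}$-free coloring of $H$ is a map $c:V(H)\to\{1,\dots,k\}$ such that each color class induces a $\mathcal{G}$-free subgraph; $\chi_{\mathcal{G}}(H)$ is the least such $k$. A list assignment $L$ assigns to each vertex $v$ a set $L(v)$ of colors; an $L$-$\mathcal{G}$-free coloring is a map $c$ with $c(v)\in L(v)$ for all $v$ whose color classes induce $\mathcal{G}$-free subgraphs. $H$ is $k$-$\mathcal{G}$-free-choosable if it has an $L$-$\mathcal{G}$-free coloring for every $L$ with $|L(v)|\ge k$ for all $v$; $\chi^L_{\mathcal{G}}(H)$ is the least such $k$. $K_n$ is the complete graph on $n$ vertices, and $H\oplus H'$ denotes the join (disjoint union plus all edges between $V(H)$ and $V(H')$). *)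

(* Defs.v *)
From mathcomp Require Import all_boot.

Set Implicit Arguments.
Unset Strict Implicit.
Unset Printing Implicit Defensive.

Record sgraph := SGraph {
  vertex :> finType;
  adj : rel vertex;
  adj_sym : symmetric adj;
  adj_irrefl : irreflexive adj }.

Definition isomorphic (G K : sgraph) : Prop :=
  exists2 f : G -> K, bijective f & {mono f : x y / adj x y}.

Record subgraph (H : sgraph) := Subgraph {
  sub_vert : {set H};
  sub_edge : rel H;
  sub_edge_sym : symmetric sub_edge;
  sub_edgeP : forall x y, sub_edge x y ->
    [&& x \in sub_vert, y \in sub_vert & adj x y] }.

Section GraphOfSubgraph.
Variables (H : sgraph) (S : subgraph H).

Definition sub_adj : rel {x : H | x \in sub_vert S} :=
  fun x y => sub_edge S (val x) (val y).

Lemma sub_adj_sym : symmetric sub_adj.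
Proof. by move=> x y; apply: sub_edge_sym. Qed.

Lemma sub_adj_irrefl : irreflexive sub_adj.
Proof.
by move=> x; apply/negP => /sub_edgeP/and3P[_ _]; rewrite adj_irrefl.
Qed.

Definition graph_of_subgraph : sgraph := SGraph sub_adj_sym sub_adj_irrefl.
End GraphOfSubgraph.

Coercion graph_of_subgraph : subgraph >-> sgraph.

Section Induced.
Variables (H : sgraph) (A : {set H}).

Definition induced_edge : rel H :=
  fun x y => [&& x \in A, y \in A & adj x y].

Lemma induced_edge_sym : symmetric induced_edge.
Proof. by move=> x y; rewrite /induced_edge adj_sym andbCA. Qed.

Definition induced : subgraph H :=
  @Subgraph H A induced_edge induced_edge_sym (fun _ _ xy => xy).
End Induced.

Section Complete.
Variable n : nat.

Definition complete_adj : rel 'I_n := fun x y => x != y.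

Lemma complete_adj_sym : symmetric complete_adj.
Proof. by move=> x y; rewrite /complete_adj eq_sym. Qed.

Lemma complete_adj_irrefl : irreflexive complete_adj.
Proof. by move=> x; rewrite /complete_adj eqxx. Qed.

Definition complete : sgraph := SGraph complete_adj_sym complete_adj_irrefl.
End Complete.

Section Join.
Variables H K : sgraph.

Definition join_adj : rel (H + K)%type := fun u v =>
  match u, v with
  | inl x, inl y => adj x y
  | inr x, inr y => adj x y
  | _, _ => true
  end.

Lemma join_adj_sym : symmetric join_adj.
Proof. by move=> [x|x] [y|y] //=; apply: adj_sym. Qed.

Lemma join_adj_irrefl : irreflexive join_adj.
Proof. by move=> [x|x] /=; apply: adj_irrefl. Qed.

Definition join : sgraph := SGraph join_adj_sym join_adj_irrefl.
End Join.

Definition graph_collection := sgraph -> Prop.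

(* Regular graphs are nonempty: were the empty graph d-regular, it would be
   a subgraph of every graph and no graph would be free of d-regular graphs. *)
Definition regular (d : nat) : graph_collection := fun G =>
  0 < #|G| /\ forall x : G, #|[set y | adj x y]| = d.

Definition free (GG : graph_collection) (H : sgraph) : Prop :=
  forall G, GG G -> ~ exists S : subgraph H, isomorphic S G.

Definition free_coloring (GG : graph_collection) (H : sgraph) (C : finType)
    (c : H -> C) : Prop :=
  forall a : C, free GG (induced [set v | c v == a]).

Definition free_colorable (GG : graph_collection) (H : sgraph) (k : nat) : Prop :=
  exists c : H -> 'I_k, free_coloring GG c.

Definition free_choosable (GG : graph_collection) (H : sgraph) (k : nat) : Prop :=
  forall (C : finType) (L : H -> {set C}),
    (forall v, k <= #|L v|) ->
    exists2 c : H -> C, (forall v, c v \in L v) & free_coloring GG c.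

Definition is_least (P : nat -> Prop) (k : nat) : Prop :=
  P k /\ forall j, P j -> k <= j.

(* These numbers need not exist for an arbitrary collection (for example, one
   that contains the one-vertex graph), hence relations and not functions. *)
Definition is_free_chromatic_number (GG : graph_collection) (H : sgraph) :
  nat -> Prop := is_least (free_colorable GG H).

Definition is_free_choice_number (GG : graph_collection) (H : sgraph) :
  nat -> Prop := is_least (free_choosable GG H).

(* Main.v *)
(* It suffices that, for n large, every k-colorable join G = H + K_n is
   k-choosable.  Every color class meets K_n in at most d vertices, so
   n <= d k.  Let h = |H| and let the lists have size at least k.

   Try first to color H with pairwise distinct colors X and to extend to K_n,
   using every color outside X at most d times.  If this fails, Hall's theorem
   with capacities gives a set T0 of all but O(1) vertices of K_n whose lists
   span only n/d + O(1) colors.  Enlarge T0, one vertex at a time, to a set T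
   such that each v outside T has at least as many colors outside the colors
   U of T as there are vertices outside T; still |U| <= n/d + O(1).  The
   vertices outside T get pairwise distinct colors outside U.  Each list of a
   vertex of H in T misses O(1) colors of U, so these lists have at least h
   colors in common, to which the classes of a k-coloring c0 that meet H are
   injected.  If such a class contains b vertices of K_n, the corresponding
   color gets capacity b, the other colors of U get capacity d.  As c0 uses
   k colors for n vertices of K_n, each list has total capacity at least n,
   so K_n in T can be colored greedily. *)
Require Import Defs.
From mathcomp Require Import all_boot zify.
From Stdlib Require Import Classical_Prop.

Set Implicit Arguments.
Unset Strict Implicit.
Unset Printing Implicit Defensive.

Lemma is_least_exists (P : nat -> Prop) m : P m -> exists k, is_least P k.
Proof.
elim/ltn_ind: m => m IHm Pm.
have [[j [Pj lt_jm]]|no_j] := classic (exists j, P j /\ j < m).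
  exact: IHm lt_jm Pj.
exists m; split=> // j Pj; rewrite leqNgt; apply/negP => lt_jm.
by apply: no_j; exists j.
Qed.

(** * Hall's theorem with color capacities, and its consequences *)

Section Hall.
Variables (V C : finType) (x0 : C) (L : V -> {set C}).
Implicit Types (S T W : {set V}) (cap : C -> nat).

Definition colors S : {set C} := \bigcup_(v in S) L v.

Lemma colorsU S T : colors (S :|: T) = colors S :|: colors T.
Proof. exact: bigcup_setU. Qed.

Lemma sub_colors S v : v \in S -> L v \subset colors S.
Proof. by move=> vS; apply: (bigcup_sup v). Qed.

Lemma leq_sum_subset cap (A B : {set C}) :
  A \subset B -> \sum_(c in A) cap c <= \sum_(c in B) cap c.
Proof.
move=> sAB; rewrite [leqRHS](big_setID A) /= (setIidPr sAB); exact: leq_addr.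
Qed.

(** Induction on [#|W|] as in the Halmos-Vaughan proof: either a nonempty proper subset is tight and
    is colored separately from the rest, or the strict slack everywhere lets one vertex be colored
    at will. *)
Lemma hall_capacity cap W :
  (forall S, S \subset W -> #|S| <= \sum_(c in colors S) cap c) ->
  exists2 f : V -> C, {in W, forall v, f v \in L v} &
    forall c, #|[set v in W | f v == c]| <= cap c.
Proof.
elim/ltn_ind: {W}#|W| {-2}W (erefl #|W|) cap => m IHm W Wm cap hall.
have [W0|[w wW]] := set_0Vmem W.
  exists (fun=> x0) => [v|c]; first by rewrite W0 inE.
  rewrite W0 (_ : [set _ in _ | _] = set0) ?cards0 //.
  by apply/setP=> v; rewrite !inE.
have [/existsP[S /and4P[sSW S0 SW tight]]|noS] := boolP [exists S : {set V},
    [&& S \subset W, S != set0, S != W & \sum_(c in colors S) cap c == #|S|]].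
  (* a tight set exhausts the capacity of its colors *)
  have ltSW : #|S| < m by rewrite -Wm proper_card // properEneq SW.
  have [|f fL fcap] := IHm _ ltSW S erefl cap.
    by move=> T sTS; apply: hall; apply: subset_trans sSW.
  pose cap' c := if c \in colors S then 0 else cap c.
  have ltDW : #|W :\: S| < m.
    have := cardsID S W; rewrite (setIidPr sSW) Wm.
    by move: S0; rewrite -card_gt0; lia.
  have [|g gL gcap] := IHm _ ltDW (W :\: S) erefl cap'.
    move=> T sTD.
    have TS0 : T :&: S = set0.
      by apply/eqP; rewrite setI_eq0; move: sTD; rewrite subsetD => /andP[].
    have sTW : T \subset W by apply: subset_trans sTD (subsetDl _ _).
    (* Subtracting the tight equality for [S] from Hall's condition for [T :|: S] leaves the
       condition for [T] under [cap']. *)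
    have := hall (T :|: S); rewrite subUset sTW sSW colorsU => /(_ isT).
    rewrite cardsU TS0 cards0 subn0.
    rewrite (big_setID (colors S)) /= (setIidPr (subsetUr _ _)) (eqP tight).
    rewrite (_ : \sum_(c in colors T) cap' c =
      \sum_(c in (colors T :|: colors S) :\: colors S) cap c); first lia.
    rewrite (big_setID (colors S)) /= big1 ?add0n.
      rewrite setDUl setDv setU0; apply: eq_bigr => c.
      by rewrite !inE /cap' => /andP[/negPf->].
    by move=> c; rewrite inE /cap' => /andP[_ ->].
  exists (fun v => if v \in S then f v else g v) => [v vW|c].
    case: ifPn => vS; first exact: fL.
    by apply: gL; rewrite inE vS.
  have [cS|cS] := boolP (c \in colors S).
    apply: leq_trans (fcap c); apply: subset_leq_card; apply/subsetP=> v.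
    rewrite !inE; case: ifPn => [_ /andP[_ ->]//|vS /andP[vW gv]].
    have := gcap c; rewrite /cap' cS leqn0 cards_eq0 => /eqP/setP/(_ v).
    by rewrite !inE vS vW gv.
  apply: leq_trans (_ : _ <= cap' c) _; last by rewrite /cap' (negPf cS).
  apply: leq_trans (gcap c); apply: subset_leq_card; apply/subsetP=> v.
  rewrite !inE; case: ifPn => [vS /andP[_ /eqP fv]|_ /andP[-> ->]//].
  by case/negP: cS; rewrite -fv; apply: (subsetP (sub_colors vS)); apply: fL.
have strict S : S \subset W -> S != set0 -> S != W ->
    #|S| < \sum_(c in colors S) cap c.
  move=> sSW S0 SW; rewrite ltn_neqAle hall // andbT eq_sym.
  by apply: contra noS => tight; apply/existsP; exists S; rewrite sSW S0 SW.
(* No proper nonempty subset is tight: [w] takes any color [c] with capacity left, and the unit lost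
   from [cap c] is absorbed by [strict]. *)
have [c cw capc] : exists2 c, c \in L w & 0 < cap c.
  have := hall [set w].
  rewrite sub1set wW cards1 /colors big_set1 => /(_ isT) h.
  apply/exists_inP; apply: contraTT h => /exists_inPn h.
  by rewrite big1 // => c cw; apply/eqP; rewrite -leqn0 leqNgt h.
pose cap' e := cap e - (e == c).
have Dw : #|W :\ w| < m by rewrite -Wm [X in _ < X](cardsD1 w) wW.
have [|f fL fcap] := IHm _ Dw (W :\ w) erefl cap'.
  move=> S sSD; have [->|S0] := eqVneq S set0; first by rewrite cards0.
  have wS : w \notin S.
    by apply/negP => /(subsetP sSD); rewrite !inE eqxx.
  have := strict S (subset_trans sSD (subsetDl _ _)) S0.
  have -> : S != W by apply: contraNneq wS => ->.
  move=> /(_ isT); apply: contraLR; rewrite -!ltnNge => lt_S.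
  suff: \sum_(e in colors S) cap e <= \sum_(e in colors S) cap' e + 1 by lia.
  have [cS|cS] := boolP (c \in colors S).
    rewrite (bigD1 c) //= [X in X + 1](bigD1 c) //= {1}/cap' eqxx.
    rewrite (eq_bigr cap'); first lia.
    by move=> e /andP[_ /negPf]; rewrite /cap' => ->; lia.
  rewrite (eq_bigr cap'); first lia.
  move=> e eS; rewrite /cap' (_ : (e == c) = false) ?subn0 //.
  by apply: contraNF cS => /eqP<-.
exists (fun v => if v == w then c else f v) => [v vW|e].
  by case: eqP => [->//|/eqP vw]; apply: fL; rewrite !inE vw.
have fe := fcap e.
rewrite (cardsD1 w) !inE wW eqxx /=.
apply: leq_trans (_ : _ <= (c == e) + cap' e) _; last first.
  by rewrite /cap' eq_sym; case: eqP => [->|_] /=; lia.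
rewrite leq_add2l; apply: leq_trans fe; apply: subset_leq_card.
by apply/subsetP=> v; rewrite !inE => /and3P[/negPf vw -> /=]; rewrite vw.
Qed.

Lemma hall_greedy cap W :
  {in W, forall v, #|W| <= \sum_(c in L v) cap c} ->
  exists2 f : V -> C, {in W, forall v, f v \in L v} &
    forall c, #|[set v in W | f v == c]| <= cap c.
Proof.
move=> Wcap; apply: hall_capacity => S sSW.
have [->|[v vS]] := set_0Vmem S; first by rewrite cards0.
apply: leq_trans (subset_leq_card sSW) _.
apply: leq_trans (Wcap v (subsetP sSW v vS)) _.
exact: leq_sum_subset (sub_colors vS).
Qed.

Lemma distinct_representatives W :
  {in W, forall v, #|W| <= #|L v|} ->
  exists2 f : V -> C, {in W, forall v, f v \in L v} & {in W &, injective f}.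
Proof.
move=> WL; have [|f fL f1] := @hall_greedy (fun=> 1) W.
  by move=> v vW; rewrite sum1_card; apply: WL.
exists f => // u v uW vW fuv; have := f1 (f u).
by move/card_le1_eqP; apply; rewrite !inE ?uW ?vW -?fuv eqxx.
Qed.

(** A vertex that would bring fewer than [q] new colors is added until none is left; at most
    [#|~: T|] additions occur. *)
Lemma expanding_superset q T :
  exists T' : {set V}, [/\ T \subset T',
    #|colors T'| <= #|colors T| + q * #|~: T| &
    forall v, v \notin T' -> q <= #|L v :\: colors T'|].
Proof.
elim: {T}#|~: T| {-2}T (erefl #|~: T|) => [|m IHm] T Tm.
  exists T; split=> // [|v vT]; first exact: leq_addr.
  by move/eqP: Tm; rewrite cards_eq0 => /eqP/setP/(_ v); rewrite !inE vT.
have [/exists_inP[v vT lt_v]|big] :=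
    boolP [exists (v | v \notin T), #|L v :\: colors T| < q]; last first.
  exists T; split=> // [|v vT]; first exact: leq_addr.
  by rewrite leqNgt; apply: contra big => lt_v; apply/exists_inP; exists v.
have vTm : #|~: (v |: T)| = m.
  have -> : ~: (v |: T) = ~: T :\ v by apply/setP=> u; rewrite !inE negb_or.
  by move: Tm; rewrite (cardsD1 v) inE vT => -[].
have [T' [sT' cT' T'q]] := IHm _ vTm.
exists T'; split=> //; first by apply: subset_trans sT'; apply: subsetUr.
apply: leq_trans cT' _.
rewrite vTm Tm mulnS colorsU /colors big_set1 -/(colors T).
by have := cardsID (colors T) (L v); rewrite cardsU; lia.
Qed.

End Hall.

(** * Embeddings, small sets and cliques in regular-free graphs *)

(** Subgraphs need not be induced, so the image of [S] with only the image edges [E] is a copy of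
    [S] in [Y], even if [f] creates adjacencies. *)
Lemma free_embedding GG (X Y : sgraph) (f : X -> Y) :
  injective f -> {homo f : x y / adj x y} -> free GG Y -> free GG X.
Proof.
move=> f_inj f_homo Yfree G GGG [S [g g_bij g_mono]]; apply: (Yfree G GGG).
pose E : rel Y := fun u v =>
  [exists x, exists y, [&& sub_edge S x y, f x == u & f y == v]].
have EP u v :
    reflect (exists x y, [/\ sub_edge S x y, f x = u & f y = v]) (E u v).
  apply: (iffP existsP) => [[x /existsP[y /and3P[Sxy /eqP<- /eqP<-]]]|].
    by exists x, y.
  case=> x [y [Sxy <- <-]]; exists x; apply/existsP; exists y.
  by rewrite Sxy !eqxx.
have E_sym : symmetric E.
  move=> u v; apply/EP/EP => -[x [y [Sxy xu yv]]]; exists y, x;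
    by rewrite sub_edge_sym.
have E_sub u v : E u v ->
    [&& u \in f @: sub_vert S, v \in f @: sub_vert S & adj u v].
  move=> /EP[x [y [/sub_edgeP/and3P[xS yS xy] <- <-]]].
  by rewrite !imset_f ?f_homo.
have Ef x y : E (f x) (f y) = sub_edge S x y.
  apply/EP/idP => [[x' [y' [? /f_inj<- /f_inj<-]]]//|Sxy].
  by exists x, y.
pose S' := Subgraph E_sym E_sub; exists S'.
have preim (u : S') : exists x : S, f (val x) == val u.
  case: u => u /= uS'; have /imsetP[x xS ->] := uS'.
  by exists (exist _ x xS).
pose p u := xchoose (preim u).
have pE u : f (val (p u)) = val u by apply/eqP; apply: (xchooseP (preim u)).
have p_bij : bijective p.
  exists (fun x : S => exist _ (f (val x)) (imset_f f (valP x)) : S') => [u|x].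
    by apply: val_inj; rewrite /= pE.
  by apply: val_inj; apply: f_inj; rewrite pE.
exists (g \o p); first exact: bij_comp.
by move=> u v /=; rewrite g_mono /= /sub_adj -Ef !pE.
Qed.

Lemma free_induced_embedding GG (X : sgraph) (A B : {set X}) (f : X -> X) :
  {in A, forall x, f x \in B} -> {in A &, injective f} ->
  {in A &, {homo f : x y / adj x y}} ->
  free GG (induced B) -> free GG (induced A).
Proof.
move=> fAB f_inj f_homo.
pose g (x : induced A) : induced B := exist _ (f (val x)) (fAB _ (valP x)).
apply: (@free_embedding _ _ _ g) => [x y [] fxy|x y].
  by apply: val_inj; apply: f_inj fxy; apply: valP.
move=> /and3P[xA yA xy]; apply/and3P; rewrite /g /=.
by split; [exact: (fAB _ xA)|exact: (fAB _ yA)|exact: f_homo].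
Qed.

Lemma regular_card_gt d G : regular d G -> d < #|G|.
Proof.
case=> /card_gt0P[x _] reg; rewrite -(reg x).
have: [set y | adj x y] \proper [set: G].
  by rewrite properT; apply/eqP=> /setP/(_ x); rewrite !inE adj_irrefl.
by move/proper_card; rewrite cardsT.
Qed.

Lemma free_induced_small d (X : sgraph) (A : {set X}) :
  #|A| <= d -> free (regular d) (induced A).
Proof.
move=> A_le G /regular_card_gt d_lt [S [g [h hg gh] _]].
have := leq_card h (can_inj gh).
rewrite card_sig => /(leq_trans d_lt).
move=> /leq_trans/(_ (max_card _)); rewrite card_sig.
rewrite (eq_card (B := A)) //; lia.
Qed.

Lemma complete_not_free d : ~ free (regular d) (complete d.+1).
Proof.
move=> /(_ (complete d.+1)); case.
  split=> [|x /=]; first by rewrite card_ord.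
  rewrite (_ : [set y | _] = [set~ x]) ?cardsC1 ?card_ord //.
  by apply/setP=> y; rewrite !inE eq_sym.
exists (induced [set: complete d.+1]), val.
  exists (fun x : complete d.+1 => exist _ x (in_setT x)) => [[x xT]|x] //.
  exact: val_inj.
by move=> x y /=; rewrite /sub_adj /= /induced_edge !inE.
Qed.

(** With more than [d] vertices the clique would contain [complete d.+1], which is itself
    [d]-regular. *)
Lemma free_induced_clique d (X : sgraph) (A B : {set X}) :
  A \subset B -> {in A &, forall x y, x != y -> adj x y} ->
  free (regular d) (induced B) -> #|A| <= d.
Proof.
move=> sAB cliqueA Bfree; rewrite leqNgt; apply/negP => d_lt.
apply: (@complete_not_free d).
pose e (i : complete d.+1) : X := enum_val (widen_ord d_lt i).
have eA i : e i \in A by apply: enum_valP.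
pose g i : induced B := exist _ (e i) (subsetP sAB _ (eA i)).
apply: (@free_embedding _ _ _ g) Bfree => [i j [] /enum_val_inj|i j ij].
  by move=> /(congr1 val) /= ij; apply: val_inj.
have eij : e i != e j.
  apply: contra ij => /eqP /enum_val_inj /(congr1 val) /= ij.
  by apply/eqP; apply: val_inj.
apply/and3P; rewrite /g /=; split; last exact: cliqueA.
  exact: (subsetP sAB _ (eA i)).
exact: (subsetP sAB _ (eA j)).
Qed.

Lemma card_fibers (V C : finType) (W : {set V}) (f : V -> C) :
  \sum_c #|[set v in W | f v == c]| = #|W|.
Proof.
rewrite -sum1_card (partition_big f predT) //=.
by apply: eq_bigr => c _; rewrite sum1dep_card.
Qed.

Lemma leq_card_bigcup (V C : finType) (W : {set V}) (F : V -> {set C}) m :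
  {in W, forall v, #|F v| <= m} -> #|\bigcup_(v in W) F v| <= #|W| * m.
Proof.
move=> Fm; rewrite -sum_nat_const.
apply: (big_ind2 (fun (A : {set C}) x => #|A| <= x)) => [|A x B y Ax By|].
- by rewrite cards0.
- by rewrite cardsU; lia.
exact: Fm.
Qed.

(** * List colorings of the join of a graph with a large complete graph *)

Section JoinComplete.
Variables (d : nat) (H : sgraph) (n : nat).
Hypothesis d_gt0 : 0 < d.

Local Notation G := (join H (complete n)).
Local Notation h := #|H|.
Local Notation outer := [set v : G | is_inl v].
Local Notation core := [set v : G | ~~ is_inl v].

Lemma card_outer : #|outer| = h.
Proof.
rewrite -cardsT -[RHS](card_imset _ (@inl_inj H 'I_n)); congr #|pred_of_set _|.
apply/setP=> -[x|j]; rewrite !inE /=; first by rewrite imset_f.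
by symmetry; apply/imsetP=> -[].
Qed.

Lemma card_core : #|core| = n.
Proof.
rewrite -[RHS]card_ord -cardsT -[RHS](card_imset _ (@inr_inj H 'I_n)).
congr #|pred_of_set _|.
apply/setP=> -[x|j]; rewrite !inE /=; last by rewrite imset_f.
by symmetry; apply/imsetP=> -[].
Qed.

Lemma adj_core (u v : G) : ~~ (is_inl u && is_inl v) -> u != v -> adj u v.
Proof. by case: u v => [x|i] [y|j] //=; rewrite /complete_adj. Qed.

Lemma free_core_card k (c : G -> 'I_k) i :
  free_coloring (regular d) c -> #|[set v in core | c v == i]| <= d.
Proof.
move=> /(_ i); apply: free_induced_clique.
  by apply/subsetP=> v; rewrite !inE => /andP[].
move=> u v; rewrite !inE => /andP[uc _] _; apply: adj_core.
by rewrite (negPf uc).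
Qed.

Lemma free_colorable_core_bound k :
  free_colorable (regular d) G k -> n <= d * k.
Proof.
move=> [c c_free]; rewrite -card_core -(card_fibers _ c).
apply: leq_trans (_ : _ <= \sum_(i < k) d) _; last first.
  by rewrite sum_nat_const card_ord mulnC.
by apply: leq_sum => i _; apply: free_core_card.
Qed.

Section Lists.
Variables (C : finType) (L : G -> {set C}) (k : nat).
Hypotheses (L_ge : forall v, k <= #|L v|) (k_ge : n <= d * k).

(* If giving [H] pairwise distinct colors does not extend to [K_n], Hall's
   condition fails on a set containing almost all of [K_n] whose lists span
   few colors. *)
Lemma rainbow_coloring_or_dense (x0 : C) :
  h <= k ->
  (exists2 c : G -> C, (forall v, c v \in L v) & free_coloring (regular d) c) \/
  exists T : {set G}, [/\ T != set0, #|~: T| <= h + d * h &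
    d * #|colors L T| < n + d * h].
Proof.
move=> hk; have [|f fL f_inj] := @distinct_representatives _ _ x0 L outer.
  by move=> v _; rewrite card_outer; apply: leq_trans (L_ge v).
pose X := f @: outer.
have cardX : #|X| <= h by rewrite -card_outer leq_imset_card.
(* Colors of [X] are closed to the core, so their classes stay singletons; any other class has at
   most [d] vertices, too few for a [d]-regular subgraph. *)
pose cap c := if c \in X then 0 else d.
have capE (A : {set C}) : \sum_(c in A) cap c = d * #|A :\: X|.
  rewrite (big_setID X) /= big1 => [|c]; last first.
    by rewrite inE /cap => /andP[_ ->].
  rewrite mulnC -sum_nat_const; apply: eq_bigr => c.
  by rewrite inE /cap => /andP[/negPf->].
have [/existsP[S /andP[sS ltS]]|hall] := boolP [exists S : {set G},
    (S \subset core) && (\sum_(c in colors L S) cap c < #|S|)].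
  right; exists S; move: ltS; rewrite capE => ltS.
  have S0 : S != set0 by apply: contraTneq ltS => ->; rewrite cards0.
  have /set0Pn[v vS] := S0.
  have kS : k <= #|colors L S|.
    exact: leq_trans (L_ge v) (subset_leq_card (sub_colors L vS)).
  (* Since [n <= d * k <= d * #|colors L S| < #|S| + d * h], the set [S] misses fewer than [d * h]
     core vertices. *)
  have DS : #|colors L S| <= #|colors L S :\: X| + h.
    have := cardsID X (colors L S).
    by have := subset_leq_card (subsetIr (colors L S) X); lia.
  have Sn := subset_leq_card sS; rewrite card_core in Sn.
  have CS := cardsC S; rewrite card_sum card_ord in CS.
  have dDS : d * #|colors L S| <= d * #|colors L S :\: X| + d * h.
    by rewrite -mulnDr leq_mul2l DS orbT.
  have dkS : d * k <= d * #|colors L S| by rewrite leq_mul2l kS orbT.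
  by split=> //; lia.
left; have [S sS|g gL gcap] := @hall_capacity _ _ x0 L cap core.
  rewrite leqNgt; apply: contra hall => ltS.
  by apply/existsP; exists S; rewrite sS.
exists (fun v => if is_inl v then f v else g v) => [v|a].
  by case: ifPn => vo; [apply: fL|apply: gL]; rewrite inE.
apply: free_induced_small; have [aX|aX] := boolP (a \in X).
  apply: leq_trans d_gt0; apply/card_le1_eqP => u v.
  have ing w : (if is_inl w then f w else g w) == a -> w \in outer /\ f w = a.
    rewrite inE; case: ifPn => [_ /eqP//|wc gw].
    have := gcap a; rewrite /cap aX leqn0 cards_eq0 => /eqP/setP/(_ w).
    by rewrite !inE wc gw.
  rewrite !inE => /ing[uo fu] /ing[vo fv]; apply: f_inj => //.
  by rewrite fu.
apply: leq_trans (_ : _ <= cap a) _; last by rewrite /cap (negPf aX).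
apply: leq_trans (gcap a); apply: subset_leq_card; apply/subsetP=> v.
rewrite !inE; case: ifPn => // vo /eqP fv.
by case/negP: aX; rewrite -fv imset_f // inE.
Qed.

(** [q] bounds the vertices outside [T0] and also serves as the number of new colors demanded of
    each vertex left outside [T]. The bound on [k] leaves [h] common colors after up to [h + q * q]
    are removed for each vertex of [H]. *)
Lemma dense_coloring (c0 : G -> 'I_k) (T0 : {set G}) :
  let q := h + d * h in
  free_coloring (regular d) c0 -> h + h * (h + q * q) < k ->
  T0 != set0 -> #|~: T0| <= q -> d * #|colors L T0| < n + d * h ->
  exists2 c : G -> C, (forall v, c v \in L v) & free_coloring (regular d) c.
Proof.
move=> q c0_free k_gt /set0Pn[v0 v0T0] T0q T0n.
have [x0 _] : exists x0, x0 \in L v0.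
  by apply/set0Pn; rewrite -card_gt0; have := L_ge v0; lia.
have [T [sT cT Tq]] := expanding_superset L q T0.
have v0T := subsetP sT _ v0T0.
have TC : #|~: T| <= q.
  by apply: leq_trans T0q; apply: subset_leq_card; rewrite setCS.
set U := colors L T in cT Tq.
have [v|g1 g1L g1_inj] :=
    @distinct_representatives _ _ x0 (fun v => L v :\: U) (~: T).
  by rewrite inE => vT; apply: leq_trans (Tq v vT).
have kU : k <= #|U|.
  exact: leq_trans (L_ge v0) (subset_leq_card (sub_colors L v0T)).
(* Here [d * #|U| < n + d * h + d * (q * q)], while [n <= d * k <= d * #|L v|]. *)
have missing v : v \in T -> #|U :\: L v| <= h + q * q.
  move=> vT; have := cardsID (L v) U.
  rewrite (setIidPr (sub_colors L vT)) => UE; have Lv := L_ge v.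
  have qq : q * #|~: T0| <= q * q by rewrite leq_mul2l T0q orbT.
  have dU : d * #|U| <= d * #|colors L T0| + d * (q * q).
    rewrite -mulnDr leq_mul2l; apply/orP; right; lia.
  rewrite -(leq_pmul2l d_gt0) mulnDr.
  have dUE : d * #|L v| + d * #|U :\: L v| = d * #|U| by rewrite -mulnDr UE.
  have dkL : d * k <= d * #|L v| by rewrite leq_mul2l Lv orbT.
  lia.
pose K := U :\: \bigcup_(v in T :&: outer) (U :\: L v).
have cardK : h <= #|K|.
  have := cardsID (\bigcup_(v in T :&: outer) (U :\: L v)) U; rewrite -/K.
  have := subset_leq_card (subsetIr U (\bigcup_(v in T :&: outer) (U :\: L v))).
  have : #|\bigcup_(v in T :&: outer) (U :\: L v)| <= h * (h + q * q).
    apply: leq_trans (leq_card_bigcup (m := h + q * q) _) _.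
      by move=> v; rewrite inE => /andP[/missing].
    rewrite leq_mul2r -[X in _ <= X]card_outer.
    by rewrite subset_leq_card ?subsetIr ?orbT.
  lia.
have KU : K \subset U by apply: subsetDl.
have KL v c : v \in T -> is_inl v -> c \in K -> c \in L v.
  move=> vT vo; rewrite inE => /andP[cn cU]; apply: contraNT cn => cL.
  by apply/bigcupP; exists v; rewrite !inE ?vT ?cL.
pose I := c0 @: outer.
have [i _|phi phiK phi_inj] := @distinct_representatives _ _ x0 (fun=> K) I.
  by apply: leq_trans cardK; rewrite -card_outer leq_imset_card.
pose b i := #|[set v in core | c0 v == i]|.
have b_le i : b i <= d by apply: free_core_card.
(* As [phi] is injective on [I], the sum has at most one term: [cap (phi i)] is [b i], and other
   colors keep capacity [d]. *)
pose deficit c := \sum_(i in I | phi i == c) (d - b i).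
pose cap c := d - deficit c.
have [v|g2 g2L g2cap] := @hall_greedy _ _ x0 L cap (T :&: core).
  rewrite inE => /andP[vT _].
  apply: leq_trans (_ : _ <= n) _.
    by rewrite -[X in _ <= X]card_core subset_leq_card ?subsetIr.
  (* The deficits total at most the sum of all [d - b i], which is [d * k - n], so the list retains
     capacity at least [n]. *)
  have capD : d * k <= \sum_(c in L v) cap c + \sum_(c in L v) deficit c.
    apply: leq_trans (_ : _ <= d * #|L v|) _.
      by rewrite leq_mul2l L_ge orbT.
    rewrite mulnC -sum_nat_const -big_split; apply: leq_sum => c _.
    by rewrite /cap /=; lia.
  have defE : \sum_(c in L v) deficit c <= \sum_i (d - b i).
    apply: leq_trans (_ : _ <= \sum_c deficit c) _.
      by rewrite [leqRHS](bigID (mem (L v))) /= leq_addr.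
    rewrite -(partition_big phi predT) //=.
    by rewrite [leqRHS](bigID (mem I)) /= leq_addr.
  have bE : n + \sum_i (d - b i) = d * k.
    rewrite -[n]card_core -(card_fibers _ c0) -big_split /=.
    rewrite (eq_bigr (fun=> d)); first by rewrite sum_nat_const card_ord mulnC.
    by move=> i _; rewrite subnKC ?b_le.
  lia.
exists (fun v =>
  if v \in T then if is_inl v then phi (c0 v) else g2 v else g1 v).
  move=> v; case: ifPn => vT; last first.
    by have := g1L v; rewrite !inE vT => /(_ isT)/andP[].
  case: ifPn => vo; last by apply: g2L; rewrite !inE vT.
  by apply: KL => //; apply: phiK; apply: imset_f; rewrite inE.
move=> a; set A := [set v | _].
(* Three kinds of class: outside [U] at most one vertex, in [U] but not in the image of [I] at most
   [d] core vertices, and for [a = phi i] a class that embeds into class [i] of [c0]. *)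
have [aU|aU] := boolP (a \in U); last first.
  have AT v : v \in A -> v \in ~: T /\ g1 v = a.
    rewrite !inE; case: ifPn => vT; last by move/eqP.
    move=> /eqP va; case/negP: aU; rewrite -va; case: ifPn => vo.
      by apply: (subsetP KU); apply: phiK; apply: imset_f; rewrite inE.
    by apply: (subsetP (sub_colors L vT)); apply: g2L; rewrite !inE vT.
  apply: free_induced_small; apply: leq_trans d_gt0; apply/card_le1_eqP => u v.
  by move=> /AT[uT gu] /AT[vT gv]; apply: g1_inj => //; rewrite gu.
have AT v : v \in A -> v \in T /\ (if is_inl v then phi (c0 v) else g2 v) = a.
  rewrite inE; case: ifPn => vT; first by move/eqP.
  by move=> /eqP va; have := g1L v; rewrite va !inE vT aU => /(_ isT).
pose Wa := [set v in T :&: core | g2 v == a].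
have AW v : v \in A -> ~~ is_inl v -> v \in Wa.
  by move=> /AT[vT +] vc; rewrite (negPf vc) !inE vT vc => ->; rewrite eqxx.
have [/exists_inP[i iI /eqP phi_i]|noi] := boolP [exists i in I, phi i == a];
    last first.
  apply: free_induced_small.
  apply: leq_trans (leq_subr (deficit a) d); apply: leq_trans (g2cap a).
  apply: subset_leq_card; apply/subsetP=> v vA; apply: AW (vA) _.
  apply: contra noi => vo; have [_] := AT v vA; rewrite vo => va.
  by apply/exists_inP; exists (c0 v); rewrite ?va // imset_f ?inE.
have cap_a : #|Wa| <= b i.
  apply: leq_trans (g2cap a) _; rewrite /cap /deficit (bigD1 i) /=.
    by have := b_le i; lia.
  by rewrite iI phi_i /=.
(* Constant lists make representatives a mere injection of [Wa] into the core vertices of class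
   [i]. *)
have [v _|psi psiB psi_inj] :=
    @distinct_representatives _ _ v0 (fun=> [set v in core | c0 v == i]) Wa.
  exact: cap_a.
have psiP v : v \in A -> ~~ is_inl v -> ~~ is_inl (psi v) /\ c0 (psi v) = i.
  by move=> vA vc; have := psiB v (AW v vA vc); rewrite !inE => /andP[? /eqP].
have f_inj : {in A &, injective (fun v => if is_inl v then v else psi v)}.
  move=> u v uA vA /=.
  case: (boolP (is_inl u)) (psiP u uA) => uo Pu;
    case: (boolP (is_inl v)) (psiP v vA) => vo Pv // uv.
  - by have [//|] := Pv; rewrite -uv uo.
  - by have [//|] := Pu; rewrite uv vo.
  by apply: psi_inj => //; apply: AW.
apply: (free_induced_embedding _ f_inj) (c0_free i) => [v vA|u v uA vA uv].
  rewrite inE; case: ifPn => vo; last by have [//|_ ->] := psiP v vA.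
  have [_] := AT v vA; rewrite vo -phi_i => /phi_inj -> //.
  by rewrite imset_f ?inE.
(* Vertices of [H] are fixed; any other pair has a core vertex in its image, so distinctness gives
   adjacency. *)
have [/andP[-> ->]//|uvo] := boolP (is_inl u && is_inl v).
apply: adj_core.
  move: uvo; rewrite !negb_and => /orP[uo|vo].
    by rewrite (negPf uo) (psiP u uA uo).1.
  by rewrite (negPf vo) (psiP v vA vo).1 orbT.
by apply: contraTneq uv => /f_inj -> //; rewrite adj_irrefl.
Qed.

End Lists.

Lemma colorable_choosable k :
  let q := h + d * h in d * (h + h * (h + q * q)) < n ->
  free_colorable (regular d) G k -> free_choosable (regular d) G k.
Proof.
move=> q n_gt colk C L L_ge; have k_ge := free_colorable_core_bound colk.
(* The lower bound on [n] passes to [k] through [n <= d * k]. *)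
have k_gt : h + h * (h + q * q) < k by rewrite -(ltn_pmul2l d_gt0); lia.
have [v0 _] : exists v0 : G, v0 \in core.
  by apply/set0Pn; rewrite -card_gt0 card_core; lia.
have [x0 _] : exists x0, x0 \in L v0.
  by apply/set0Pn; rewrite -card_gt0; have := L_ge v0; lia.
have [|//|[T [T0 TC Tn]]] := rainbow_coloring_or_dense L_ge k_ge x0.
  lia.
have [c0 c0_free] := colk.
exact: (dense_coloring L_ge k_ge c0_free k_gt T0 TC Tn).
Qed.

End JoinComplete.

(** * Comparison of the chromatic and choice numbers *)

Lemma choosable_colorable GG (G : sgraph) k :
  free_choosable GG G k -> free_colorable GG G k.
Proof.
move=> /(_ _ (fun=> [set: 'I_k])) [].
  by move=> v; rewrite cardsT card_ord.
by move=> c _ c_free; exists c.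
Qed.

Lemma regular_free_colorable d (G : sgraph) :
  0 < d -> free_colorable (regular d) G #|G|.
Proof.
move=> d_gt0; exists enum_rank => a; apply: free_induced_small.
apply: leq_trans d_gt0; apply/card_le1_eqP => u v; rewrite !inE.
by move=> /eqP ua /eqP va; apply: enum_rank_inj; rewrite ua.
Qed.

Theorem theorem4 (d : nat) (hd : 1 <= d) (H : sgraph) :
  exists n' : nat, forall n : nat, n' <= n ->
    exists k : nat,
      is_free_chromatic_number (regular d) (join H (complete n)) k /\
      is_free_choice_number (regular d) (join H (complete n)) k.
Proof.
pose q := #|H| + d * #|H|.
exists (d * (#|H| + #|H| * (#|H| + q * q))).+1 => n n_gt.
(* Pairwise distinct colors witness colorability, so a least [k] exists; constant lists show that no
   smaller number is a choice number. *)
have [k [colk k_min]] :=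
  is_least_exists (regular_free_colorable (join H (complete n)) hd).
exists k; split=> //; split; first exact: colorable_choosable.
by move=> j /choosable_colorable; apply: k_min.
Qed.
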